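(* Let $V_1,V_2$ be finite-dimensional complex vector spaces of dimensions $p_1,p_2>0$, and let $[f]\in\mathbb P(\operatorname{Hom}(V_1,V_2)^\vee)$ be the class of a nonzero homomorphism $f\colon V_1\to V_2$. Let $(\lambda_1,\lambda_2)$ be any one parameter subgroup of $\mathrm{SL}(V_1)\times\mathrm{SL}(V_2)$, specified by bases $v_1^j,\dots,v_{p_j}^j$ of $V_j$, $j=1,2$, and the weight vector $(\underline\gamma^1,\underline\gamma^2)$, and write $f=\sum_{i,j}f_{i,j}\,(v_i^1)^\vee\otimes v_j^2$. Then there exist indices $i(1)_*$ and $i(2)_*$ with $f_{i(1)_*i(2)_*}\ne0$ such that $$\mu([f],(\lambda_1,\lambda_2))=\mu\bigl([(v^1_{i(1)_*})^\vee\otimes v^2_{i(2)_*}],(\lambda_1,\lambda_2)\bigr),$$ and a decomposition $$(\underline\gamma^1,\underline\gamma^2)=\sum_{\substack{i(1)=0,\dots,p_1-1\\ i(2)=0,\dots,p_2-1}}\eta_{i(1)i(2)}\Bigl(\tfrac1{p_1}\gamma^{1,(i(1))},\tfrac1{p_2}\gamma^{2,(i(2))}\Bigr)$$ such that all coefficients $\eta_{i(1)i(2)}$ are non-negative rational numbers and, whenever $\eta_{i(1)i(2)}\ne0$, the weight vector $\bigl(\tfrac1{p_1}\gamma^{1,(i(1))},\tfrac1{p_2}\gamma^{2,(i(2))}\bigr)$ is basic w.r.t. $[f]$ and $$\mu\bigl([f],\lambda^{(i(1),i(2))}\bigr)=\mu\bigl([(v^1_{i(1)_*})^\vee\otimes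 v^2_{i(2)_*}],\lambda^{(i(1),i(2))}\bigr).$$
   Context: $\mathbb P(E)$ is the space of hyperplanes in $E$, so $\mathbb P(\operatorname{Hom}(V_1,V_2)^\vee)$ is the space of lines in $\operatorname{Hom}(V_1,V_2)$; $\mathrm{SL}(V_1)\times\mathrm{SL}(V_2)$ acts by $(g_1,g_2)\cdot f=g_2fg_1^{-1}$. A one parameter subgroup $\lambda_j$ of $\mathrm{SL}(V_j)$ is given by a basis $v_1^j,\dots,v_{p_j}^j$ of $V_j$ and a weight vector $\underline\gamma^j=(\gamma_1^j,\dots,\gamma_{p_j}^j)$ of integers with $\gamma_1^j\le\dots\le\gamma_{p_j}^j$ and sum $0$, via $\lambda_j(z)v_k^j=z^{\gamma_k^j}v_k^j$. Formal one parameter subgroups are defined in the same way with rational weights. $\mu([f],(\lambda_1,\lambda_2))$ is the weight of the induced $\mathbb C^*$-action on the fibre of $\mathcal O(-1)$ over $\lim_{z\to\infty}(\lambda_1(z),\lambda_2(z))\cdot[f]$; explicitly it equals $\max\{-\gamma_i^1+\gamma_j^2: f_{i,j}\ne0\}$, and this formula is used for formal one parameter subgroups as well. For $k=0,\dots,p_j$ put $V_j^{(k)}=\langle v_1^j,\dots,v_k^j\rangle$ and $\gamma^{j,(k)}=(k-p_j,\dots,k-p_j,k,\dots,k)$ with $k-p_j$ occurring $k$ times. $\lambda^{(i(1),i(2))}$ is the formal one parameter subgroup of $\mathrm{SL}(V_1)\times\mathrm{SL}(V_2)$ given by these bases and the weight vector $(\tfrac1{p_1}\gamma^{1,(i(1))},\tfrac1{p_2}\gamma^{2,(i(2))})$.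 The weight vector $(\tfrac1{p_1}\gamma^{1,(i(1))},\tfrac1{p_2}\gamma^{2,(i(2))})$ is called basic w.r.t. $[f]$ if either at least one of the conditions $0<i(1)<p_1$, $0<i(2)<p_2$ fails, or both hold and moreover $f(V_1^{(i(1))})\subset V_2^{(i(2))}$, $V_1^{(i(1))}\not\subset\ker f$, and $V_2^{(i(2))}\not\supset\operatorname{Im}f$. (This is the specialization to the quiver $1\to2$ of the paper's definition of basic weight vectors.) *)

(* Defs.v *)
From HB Require Import structures.
From mathcomp Require Import all_boot all_order all_algebra.
From mathcomp Require Import complex.
From mathcomp Require Import reals.
Set Implicit Arguments.
Unset Strict Implicit.
Unset Printing Implicit Defensive.
Import Order.TTheory GRing.Theory Num.Theory.
Local Open Scope ring_scope.

Section OneParameterSubgroups.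
Variables (K : fieldType) (V : vectType K) (p : nat).
Implicit Types (b : p.-tuple V) (k : nat).

Definition is_weight_vector (g : 'rV[int]_p) : Prop :=
  (forall i j : 'I_p, (i <= j)%N -> g 0 i <= g 0 j) /\ \sum_i g 0 i = 0.

Definition ratw (g : 'rV[int]_p) : 'rV[rat]_p := map_mx intr g.

Definition ops b (g : 'rV[int]_p) (z : K) : 'End(V) :=
  linfun (fun v => \sum_k (z ^ g 0 k * coord b k v) *: b`_k).

Definition flag b k : {vspace V} := <<take k b>>%VS.

(* Ordinals are 0-based: the first k entries, equal to k - p, are those of
   index m < k. *)
Definition step_weight k : 'rV[rat]_p :=
  \row_(m < p) (if (m < k)%N then k%:R - p%:R else k%:R).

End OneParameterSubgroups.

Arguments step_weight : clear implicits.

Section HomSpace.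
Variables (K : fieldType) (V1 V2 : vectType K) (p1 p2 : nat).
Variables (b1 : p1.-tuple V1) (b2 : p2.-tuple V2).
Implicit Types f : 'Hom(V1, V2).

Definition coef f (i : 'I_p1) (j : 'I_p2) : K := coord b2 j (f b1`_i).

(* (v_i^1)^\vee \otimes v_j^2 *)
Definition elem (i : 'I_p1) (j : 'I_p2) : 'Hom(V1, V2) :=
  linfun (fun x => coord b1 i x *: b2`_j).

(* mu([f], lambda) for the formal one parameter subgroup lambda with bases
   b1, b2 and weights w; junk for f = 0. By muZ it depends only on the class
   of f up to nonzero scalars. The default of the maximum is itself one of the
   values, so that negative maxima are not cut off at 0. *)
Definition mu f (w : 'rV[rat]_p1 * 'rV[rat]_p2) : rat :=
  let s := [seq - w.1 0 ij.1 + w.2 0 ij.2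
             | ij <- enum {: 'I_p1 * 'I_p2} & coef f ij.1 ij.2 != 0] in
  \big[Num.max/head 0 s]_(x <- s) x.

(* The weight vector of the formal one parameter subgroup lambda^(k1, k2). *)
Definition step_pair (k1 k2 : nat) : 'rV[rat]_p1 * 'rV[rat]_p2 :=
  (p1%:R^-1 *: step_weight p1 k1, p2%:R^-1 *: step_weight p2 k2).

Definition basic f (k1 k2 : nat) : Prop :=
  ~ ((0 < k1 < p1)%N /\ (0 < k2 < p2)%N) \/
  [/\ (0 < k1 < p1)%N, (0 < k2 < p2)%N,
      (f @: flag b1 k1 <= flag b2 k2)%VS,
      ~ (flag b1 k1 <= lker f)%VS
    & ~ (limg f <= flag b2 k2)%VS].

Definition act (g1 : 'End(V1)) (g2 : 'End(V2)) f : 'Hom(V1, V2) :=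
  (g2 \o f \o g1^-1)%VF.

End HomSpace.

Arguments step_pair : clear implicits.

(* The geometric definition of mu([f], lambda), for integral weights: the
   weight of the C^*-action on the fibre of O(-1), i.e. on the line spanned by
   h, over [h] = lim_(z -> oo) lambda(z).[f]. Convergence of lines is
   convergence of suitably rescaled representatives, which is tested on the
   coordinates of the finite-dimensional space Hom(V1, V2).
   Lemma fibre_weightE identifies this weight with mu. *)
Section FibreWeight.
Variables (R : realType) (V1 V2 : vectType R[i]) (p1 p2 : nat).
Variables (b1 : p1.-tuple V1) (b2 : p2.-tuple V2).
Variables (g1 : 'rV[int]_p1) (g2 : 'rV[int]_p2).
Implicit Types f h : 'Hom(V1, V2).

Definition lim_infty (F : R[i] -> 'Hom(V1, V2)) h : Prop :=
  forall (i : 'I_p1) (j : 'I_p2) (e : R), 0 < e ->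
    exists M : R, forall z : R[i], M%:C%C < `|z| ->
      `|coef b1 b2 (F z - h) i j| < e%:C%C.

Definition fibre_weight f (m : int) : Prop :=
  exists2 h : 'Hom(V1, V2), h != 0 &
    (exists c : R[i] -> R[i], (forall z, z != 0 -> c z != 0) /\
       lim_infty (fun z => c z *: act (ops b1 g1 z) (ops b2 g2 z) f) h) /\
    (forall z, z != 0 -> act (ops b1 g1 z) (ops b2 g2 z) h = z ^ m *: h).

End FibreWeight.

Section HomSpaceTheory.
Variables (K : fieldType) (V1 V2 : vectType K) (p1 p2 : nat).
Variables (b1 : p1.-tuple V1) (b2 : p2.-tuple V2).
Hypotheses (basis_b1 : basis_of fullv b1) (basis_b2 : basis_of fullv b2).
Implicit Types f h : 'Hom(V1, V2).

Lemma linfun_linearE (U W : vectType K) (f : U -> W) :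
  linear f -> linfun f =1 f.
Proof.
move=> lf; pose fL := GRing.isLinear.Build K U W *:%R f lf.
pose ff : {linear U -> W} := HB.pack f fL.
by move=> u; rewrite -[f]/(ff : U -> W) lfunE.
Qed.

Lemma opsE (V : vectType K) p (b : p.-tuple V) (g : 'rV[int]_p) (z : K) v :
  ops b g z v = \sum_k (z ^ g 0 k * coord b k v) *: b`_k.
Proof.
rewrite /ops linfun_linearE // => a x y.
rewrite scaler_sumr -big_split; apply: eq_bigr => k _ /=.
by rewrite linearP /= mulrDr scalerDl scalerA mulrCA.
Qed.

Lemma ops_basisE (V : vectType K) p (b : p.-tuple V) (g : 'rV[int]_p) (z : K)
    (i : 'I_p) : free b -> ops b g z b`_i = z ^ g 0 i *: b`_i.
Proof.
move=> fb; rewrite opsE (bigD1 i) //= big1 ?addr0 => [|k /negPf ki].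
  by rewrite coord_free // eqxx mulr1.
by rewrite coord_free // eq_sym ki mulr0 scale0r.
Qed.

Lemma elemE i j x : elem b1 b2 i j x = coord b1 i x *: b2`_j.
Proof.
rewrite /elem linfun_linearE // => a u v.
by rewrite linearP /= scalerDl scalerA.
Qed.

Lemma coef_elem i j k l :
  coef b1 b2 (elem b1 b2 i j) k l = ((i == k) && (j == l))%:R.
Proof.
rewrite /coef elemE coord_free ?(basis_free basis_b1) //.
rewrite linearZ /= coord_free ?(basis_free basis_b2) // -natrM mulnb.
by rewrite (eq_sym k).
Qed.

Lemma coefZ c f i j : coef b1 b2 (c *: f) i j = c * coef b1 b2 f i j.
Proof. by rewrite /coef scale_lfunE linearZ. Qed.

Lemma coefB f h i j :
  coef b1 b2 (f - h) i j = coef b1 b2 f i j - coef b1 b2 h i j.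
Proof. by rewrite /coef add_lfunE opp_lfunE linearB. Qed.

Lemma coef_inj f h :
  (forall i j, coef b1 b2 f i j = coef b1 b2 h i j) -> f = h.
Proof.
move=> fh; apply/lfunP => v; rewrite (coord_basis basis_b1 (memvf v)).
rewrite !linear_sum; apply: eq_bigr => i _; rewrite !linearZ /=; congr (_ *: _).
rewrite (coord_basis basis_b2 (memvf (f _))).
rewrite (coord_basis basis_b2 (memvf (h _))).
by apply: eq_bigr => j _; rewrite -!/(coef _ _ _ _ _) fh.
Qed.

Lemma coef_neq0 f : f != 0 -> exists i j, coef b1 b2 f i j != 0.
Proof.
move=> f0; suff /existsP[i /existsP[j ij]] :
  [exists i, exists j, coef b1 b2 f i j != 0] by exists i, j.
apply: contraR f0 => /existsPn f0; apply/eqP/coef_inj => i j.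
have /existsPn/(_ j) := f0 i; rewrite negbK => /eqP ->.
by rewrite /coef zero_lfunE linear0.
Qed.

Lemma coef_ex (F : 'I_p1 -> 'I_p2 -> K) :
  exists h, forall i j, coef b1 b2 h i j = F i j.
Proof.
exists (\sum_i \sum_j F i j *: elem b1 b2 i j) => k l.
rewrite /coef sum_lfunE linear_sum (bigD1 k) //= [X in _ + X]big1 ?addr0.
  rewrite sum_lfunE linear_sum (bigD1 l) //= big1 ?addr0 => [|j /negPf jl].
    by rewrite scale_lfunE linearZ /= -/(coef _ _ _ _ _) coef_elem !eqxx mulr1.
  rewrite scale_lfunE linearZ /= -/(coef _ _ _ _ _) coef_elem jl andbF.
  by rewrite mulr0.
move=> i /negPf ik; rewrite sum_lfunE linear_sum big1 // => j _.
by rewrite scale_lfunE linearZ /= -/(coef _ _ _ _ _) coef_elem ik mulr0.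
Qed.

Lemma coef_expansion f :
  f = \sum_i \sum_j coef b1 b2 f i j *: elem b1 b2 i j.
Proof.
apply/lfunP => v; rewrite sum_lfunE {1}(coord_basis basis_b1 (memvf v)).
rewrite linear_sum; apply: eq_bigr => i _; rewrite linearZ sum_lfunE /=.
rewrite {1}(coord_basis basis_b2 (memvf (f _))) scaler_sumr.
apply: eq_bigr => j _; rewrite scale_lfunE elemE !scalerA.
by rewrite mulrC.
Qed.

Lemma muZ c f w : c != 0 -> mu b1 b2 (c *: f) w = mu b1 b2 f w.
Proof.
move=> c0; rewrite /mu (@eq_filter _ _ (fun ij => coef b1 b2 f ij.1 ij.2 != 0)).
  by [].
by move=> ij; rewrite coefZ mulf_eq0 (negPf c0).
Qed.

Lemma mu_max f w : f != 0 ->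
  (exists i j, coef b1 b2 f i j != 0 /\ mu b1 b2 f w = - w.1 0 i + w.2 0 j)
  /\ (forall i j, coef b1 b2 f i j != 0 -> - w.1 0 i + w.2 0 j <= mu b1 b2 f w).
Proof.
move=> f0; rewrite /mu; set s := map _ _.
have [i0 [j0 ij0]] := coef_neq0 f0.
have sP x : reflect (exists i j, coef b1 b2 f i j != 0 /\
    x = - w.1 0 i + w.2 0 j) (x \in s).
  apply: (iffP mapP) => [[[i j]] | [i [j [ij ->]]]].
    by rewrite mem_filter => /andP[ij _] ->; exists i, j.
  by exists (i, j) => //; rewrite mem_filter ij mem_enum.
have hs : head 0 s \in s.
  have : - w.1 0 i0 + w.2 0 j0 \in s by apply/sP; exists i0, j0.
  by case: (s) => //= a t _; rewrite mem_head.
split=> [|i j ij]; last first.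
  have : - w.1 0 i + w.2 0 j \in s by apply/sP; exists i, j.
  elim: (s) (head 0 s) => //= a t IH d; rewrite inE big_cons le_max.
  by case/predU1P => [->|/IH ->]; rewrite ?lexx ?orbT.
apply/sP; rewrite big_seq; elim/big_ind: _ => // x y xs ys.
by rewrite maxEle; case: ifP.
Qed.

Lemma coef_act (g1 : 'rV[int]_p1) (g2 : 'rV[int]_p2) z f i j : z != 0 ->
  coef b1 b2 (act (ops b1 g1 z) (ops b2 g2 z) f) i j
    = z ^ (- g1 0 i + g2 0 j) * coef b1 b2 f i j.
Proof.
move=> z0; have fb1 := basis_free basis_b1; have fb2 := basis_free basis_b2.
have k0 : lker (ops b1 g1 z) == 0%VS.
  rewrite -subv0; apply/subvP => v; rewrite memv_ker memv0 opsE => /eqP v0.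
  apply/eqP; rewrite (coord_basis basis_b1 (memvf v)) big1 // => k _.
  have /freeP/(_ _ v0 k)/eqP := fb1.
  by rewrite mulf_eq0 expfz_eq0 (negPf z0) andbF /= => /eqP ->; rewrite scale0r.
have inv_b1 : ((ops b1 g1 z)^-1)%VF b1`_i = z ^ (- g1 0 i) *: b1`_i.
  rewrite -[RHS](lker0_lfunK k0) linearZ /= ops_basisE // scalerA -expfzDr //.
  by rewrite addNr expr0z scale1r.
rewrite /coef /act !comp_lfunE inv_b1 !linearZ /= expfzDr // -mulrA.
congr (_ * _); rewrite opsE linear_sum (bigD1 j) //= big1 ?addr0 => [|k /negPf kj].
  by rewrite linearZ /= coord_free // eqxx mulr1.
by rewrite linearZ /= coord_free // kj mulr0.
Qed.
End HomSpaceTheory.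

Section FibreWeightTheory.
Variables (R : realType) (V1 V2 : vectType R[i]) (p1 p2 : nat).
Variables (b1 : p1.-tuple V1) (b2 : p2.-tuple V2).
Variables (g1 : 'rV[int]_p1) (g2 : 'rV[int]_p2).
Hypotheses (basis_b1 : basis_of fullv b1) (basis_b2 : basis_of fullv b2).
Implicit Types f h : 'Hom(V1, V2).

Let e i j : int := - g1 0 i + g2 0 j.

Lemma lec_normexpz (z : R[i]) (n : int) : 1 <= `|z| -> n <= 0 -> `|z ^ n| <= 1.
Proof.
move=> z1; have z0 : 0 < `|z| by rewrite (lt_le_trans ltr01).
case: n => [[|n]|n] // _; first by rewrite expr0z normr1.
by rewrite NegzE -invr_expz normfV normrX invf_le1 ?exprn_ege1 ?exprn_gt0.
Qed.

Lemma fibre_weightE f (m : int) : f != 0 ->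
  fibre_weight b1 b2 g1 g2 f m <-> m%:~R = mu b1 b2 f (ratw g1, ratw g2).
Proof.
move=> f0; have [[a [b [fab ->]]] maxab] :=
  mu_max basis_b1 basis_b2 (ratw g1, ratw g2) f0.
have eE i j : - (ratw g1) 0 i + (ratw g2) 0 j = (e i j)%:~R.
  by rewrite !mxE -rmorphN -rmorphD.
have {}maxab i j : coef b1 b2 f i j != 0 -> e i j <= e a b.
  by move/maxab; rewrite /= !eE ler_int.
rewrite /= eE; suff -> : fibre_weight b1 b2 g1 g2 f m <-> m = e a b.
  by split=> [-> //|/intr_inj].
split=> [[h h0 [[c [c0 lim]] wt]] | ->].
  have hwt i j : coef b1 b2 h i j != 0 -> e i j = m.
    move=> hij; have two0 : (2 : R[i]) != 0 by rewrite pnatr_eq0.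
    have := congr1 (fun x => coef b1 b2 x i j) (wt 2 two0).
    rewrite (coef_act basis_b1 basis_b2) // coefZ => /(mulIf hij) H.
    have : (2 : R[i]) ^ (e i j - m) == 1.
      by rewrite expfzDr // H -expfzDr // subrr expr0z.
    by rewrite pexprz_eq1 ?ler0n // (eqr_nat _ 2 1) orbF subr_eq0 => /eqP.
  have limE i j (eps : R) : 0 < eps -> exists M : R, forall z : R[i],
      M%:C%C < `|z| -> 1 <= `|z| ->
      `|c z * z ^ e i j * coef b1 b2 f i j - coef b1 b2 h i j| < eps%:C%C.
    move=> /lim - /(_ i j) [M HM]; exists M => z Mz z1.
    have z0 : z != 0 by rewrite -normr_gt0 (lt_le_trans ltr01).
    by have := HM z Mz; rewrite coefB coefZ coef_act // mulrA.
  have big (M : R) : exists z : R[i], M%:C%C < `|z| /\ 1 <= `|z|.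
    exists (1 + `|M|)%:C%C.
    have -> : `|(1 + `|M|)%:C%C| = (1 + `|M|)%:C%C :> R[i].
      by rewrite ger0_norm // (lecR 0) addr_ge0.
    split; last by rewrite (lecR 1) lerDl.
    by rewrite ltcR (le_lt_trans (ler_norm _)) // ltrDr.
  apply/esym/eqP; apply/negPn/negP => /eqP ne.
  have hab : coef b1 b2 h a b = 0.
    by apply/eqP/negPn/negP => /hwt.
  have [i0 [j0 h00]] := coef_neq0 basis_b1 basis_b2 h0.
  pose n (x : R[i]) : R := Normc.normc x.
  have nE x : (n x)%:C%C = `|x| by [].
  have n_gt0 x : x != 0 -> 0 < n x by rewrite -ltcR nE normr_gt0.
  have f00 : coef b1 b2 f i0 j0 != 0.
    apply/eqP => f00; have [M HM] := limE i0 j0 _ (n_gt0 _ h00).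
    have [z [Mz z1]] := big M; have := HM z Mz z1.
    by rewrite f00 mulr0 sub0r normrN nE ltxx.
  have [] := limE i0 j0 (n (coef b1 b2 h i0 j0) / 2).
    by rewrite divr_gt0 ?n_gt0.
  move=> M1 HM1.
  have [] := limE a b (n (coef b1 b2 f a b)
    * (n (coef b1 b2 h i0 j0) / 2 / n (coef b1 b2 f i0 j0))).
    by rewrite mulr_gt0 ?divr_gt0 ?n_gt0.
  move=> M2 HM2; have [z [Mz z1]] := big (Num.max M1 M2).
  have {}HM1 := HM1 z (le_lt_trans (_ : M1%:C%C <= _) Mz) z1.
  have {}HM2 := HM2 z (le_lt_trans (_ : M2%:C%C <= _) Mz) z1.
  have z0 : z != 0 by rewrite -normr_gt0 (lt_le_trans ltr01).
  have nM x y : n (x * y) = n x * n y by exact: Normc.normcM.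
  move: HM1 HM2; rewrite !lecR !le_max !lexx orbT hab subr0 -!nE !ltcR.
  move=> /(_ isT) HM1 /(_ isT).
  rewrite nM mulrC ltr_pM2l ?n_gt0 // ltr_pdivlMr ?n_gt0 // => HM2.
  have zn : n (z ^ (e i0 j0 - e a b)) <= 1.
    by rewrite -lecR nE lec_normexpz // subr_le0 maxab.
  set y := c z * z ^ e i0 j0 * coef b1 b2 f i0 j0 in HM1.
  have ny : n y < n (coef b1 b2 h i0 j0) / 2.
    apply: le_lt_trans HM2; rewrite /y nM ler_pM2r ?n_gt0 //.
    have -> : z ^ e i0 j0 = z ^ e a b * z ^ (e i0 j0 - e a b).
      by rewrite -expfzDr // subrKC.
    rewrite mulrA nM ler_piMr // -(lecR 0) nE normr_ge0 //.
  have : n (coef b1 b2 h i0 j0) <= n (y - coef b1 b2 h i0 j0) + n y.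
    rewrite -lecR rmorphD /= !nE distrC.
    by rewrite -{1}(subrK y (coef b1 b2 h i0 j0)) ler_normD.
  apply/negP; rewrite -ltNge [ltRHS]splitr; exact: ltrD.
have [h hE] := coef_ex basis_b1 basis_b2
  (fun i j => coef b1 b2 f i j *+ (e i j == e a b)).
exists h.
  apply: contraNneq fab => h0; have := hE a b.
  by rewrite h0 /coef zero_lfunE linear0 eqxx mulr1n => <-.
split; last first.
  move=> z z0; apply: (coef_inj basis_b1 basis_b2) => i j.
  rewrite (coef_act basis_b1 basis_b2) // coefZ hE -/(e i j).
  by case: eqP => [-> //|_]; rewrite !mulr0.
exists (fun z => z ^ (- e a b)); split=> [z z0|i j eps eps0].
  by rewrite expfz_neq0.
pose k := Normc.normc (coef b1 b2 f i j).
have kE : k%:C%C = `|coef b1 b2 f i j| by [].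
have k0 : 0 <= k by rewrite -(lecR 0) kE normr_ge0.
exists (1 + k / eps) => z Mz.
have z1 : 1 <= `|z|.
  apply: le_trans (ltW Mz); rewrite (lecR 1) lerDl divr_ge0 // ltW //.
have z0 : z != 0 by rewrite -normr_gt0 (lt_le_trans ltr01).
rewrite coefB coefZ (coef_act basis_b1 basis_b2) // hE -/(e i j) mulrA.
rewrite -expfzDr //.
have [->|ne] := eqVneq (e i j) (e a b).
  by rewrite addNr expr0z mul1r subrr normr0 (ltcR 0).
rewrite subr0; have [->|fij] := eqVneq (coef b1 b2 f i j) 0.
  by rewrite mulr0 normr0 (ltcR 0).
have lte : - e a b + e i j + 1 <= 0.
  have : e i j < e a b by rewrite lt_neqAle ne maxab.
  by rewrite -addrA [- _ + _]addrC subr_le0 lezD1.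
have := lec_normexpz z1 lte; rewrite (expfzDr _ 1 z0) (_ : z ^ 1%R = z) // normrM => zle.
rewrite normrM -kE.
have nz : 0 < `|z| by rewrite normr_gt0.
rewrite -(ltr_pM2r nz) mulrAC.
apply: (@le_lt_trans _ _ k%:C%C).
  by rewrite ler_piMl // (lecR 0).
have : eps%:C%C * (1 + k / eps)%:C%C < eps%:C%C * `|z|.
  by rewrite ltr_pM2l ?(ltcR 0).
apply: lt_trans; rewrite -[X in _ < X](rmorphM (real_complex R)) ltcR mulrDr.
by rewrite mulr1 mulrC divfK ?gt_eqF // ltrDr.
Qed.
End FibreWeightTheory.

(* Main.v *)
Require Import Defs.
From HB Require Import structures.
From mathcomp Require Import all_boot all_order all_algebra.
From mathcomp Require Import complex.
From mathcomp Require Import reals.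
From mathcomp Require Import zify lra.
Set Implicit Arguments.
Unset Strict Implicit.
Unset Printing Implicit Defensive.
Import Order.TTheory GRing.Theory Num.Theory.
Local Open Scope ring_scope.

(** Put [m = mu([f], lambda)] and let [(i1, i2)] be a place of the support of
[f] where [m] is attained, so that [g2 i2 = g1 i1 + m].

The idea is to write both weight vectors as superpositions of steps cut out by
a common moving threshold. For an integer [s], let [k1] be the number of
indices [i] with [g1 i <= s], and [k2] the number of indices [j] with
[g2 j <= s + m]. As the weights are sorted, [i < k1] means [g1 i <= s] and
[j < k2] means [g2 j <= s + m]. Every weight is, up to an additive constant, a
sum over thresholds of minus the indicator of being below the threshold; both
sides having trace zero, the constant vanishes ([ratw_layer_cake]). Hence
[(g1, g2)] is the sum of the step pairs [(k1, k2)] as [s] runs through a long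
enough interval of integers.

The shift by [m] makes each of these step pairs compatible with [f]. Up to a
constant, the weight of the step pair [(k1, k2)] at [(i, j)] is
[(i < k1) - (j < k2)]. If [f] has a non-zero coefficient at [(i, j)], then
[g2 j <= g1 i + m], so [i < k1] implies [j < k2]; this is the inclusion of
[f(V1^(k1))] in [V2^(k2)], and it bounds all these weights by 0. At [(i1, i2)]
equality holds, so [i1 < k1] and [i2 < k2] are equivalent and the bound is
attained there.

Such a step pair need not be basic, as [f] may kill [V1^(k1)] or have image in
[V2^(k2)]. In both cases it is the sum of the step pairs [(k1, 0)] and
[(0, k2)], which are basic for trivial reasons and still attain their maximum
at [(i1, i2)] ([basic_cone_step_pair]). *)

(** * Step weight vectors and the layer-cake decomposition *)

Lemma card_ord_lt p k : (k <= p)%N -> #|[pred m : 'I_p | (m < k)%N]| = k.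
Proof.
by move=> kp; rewrite -sum1_card -(big_ord_widen p (fun=> 1%N)) // sum1_card card_ord.
Qed.

Lemma sum_geq_ord n d : (\sum_(t < n) (d <= t) = n - d)%N.
Proof. by elim: n => [|n IH]; [rewrite big_ord0 | rewrite big_ord_recr IH /=; lia]. Qed.

Lemma scaled_step_weightE p k (m : 'I_p) :
  (p%:R^-1 *: step_weight p k) 0 m = k%:R / p%:R - (m < k)%:R.
Proof.
have p0 : (p%:R : rat) != 0 by rewrite pnatr_eq0; case: p m => [[]|].
by rewrite !mxE mulrC; case: ifP => _; rewrite ?subr0 // mulrBl divff.
Qed.

Lemma step_weight0 p : step_weight p 0 = 0.
Proof. by apply/rowP => m; rewrite !mxE. Qed.

Lemma step_weight_full p : step_weight p p = 0.
Proof. by apply/rowP => m; rewrite !mxE ltn_ord subrr. Qed.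

Lemma sum_scaled_step_weight p k : (k <= p)%N ->
  \sum_m (p%:R^-1 *: step_weight p k) 0 m = 0.
Proof.
case: p => [|p] kp; first by rewrite big_ord0.
under eq_bigr do rewrite scaled_step_weightE.
rewrite sumrB sumr_const card_ord -natr_sum -big_mkcond /= sum1_card.
by rewrite card_ord_lt // -[X in X - _]mulr_natr divfK ?pnatr_eq0 // subrr.
Qed.

Section Level.
Variables (p : nat) (g : 'rV[int]_p).

Definition level (s : int) : nat := #|[pred m : 'I_p | g 0 m <= s]|.

Lemma level_le s : (level s <= p)%N.
Proof. by rewrite -[leqRHS]card_ord max_card. Qed.

Hypothesis weight_g : is_weight_vector g.

(** Because [g] is sorted, the indices of weight at most [s] form an initial
segment. *)
Lemma lt_level s (i : 'I_p) : (i < level s)%N = (g 0 i <= s).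
Proof.
have [mono _] := weight_g; apply/idP/idP => [|gi].
  apply: contraTT; rewrite -leqNgt -ltNge => gi.
  rewrite -[leqRHS](card_ord_lt (ltnW (ltn_ord i))).
  apply/subset_leq_card/subsetP => m; rewrite !inE => gm.
  by rewrite ltnNge; apply: contraL gm => /mono im; rewrite -ltNge (lt_le_trans gi).
rewrite -[leqLHS](card_ord_lt (ltn_ord i)).
apply/subset_leq_card/subsetP => m; rewrite !inE ltnS => /mono.
by move/le_trans; apply.
Qed.

(** The entry [g i] exceeds [c] by the number of thresholds in [c, c + n) that
lie strictly below [g i], which gives the equality up to a constant; the
constant is 0 because both sides have trace zero. *)
Lemma ratw_layer_cake (c : int) (n : nat) :
  (forall i, c <= g 0 i <= c + n%:Z) ->
  ratw g = \sum_(t < n) p%:R^-1 *: step_weight p (level (c + t%:Z)).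
Proof.
move=> gcn; have [_ trace_g] := weight_g.
set rhs := \sum_t _.
pose C : rat := \sum_(t < n) ((level (c + t%:Z))%:R / p%:R) - (c + n%:Z)%:~R.
have rhsE i : rhs 0 i = C + ratw g 0 i.
  have {gcn} := gcn i; rewrite /rhs summxE !mxE.
  under eq_bigr do rewrite scaled_step_weightE lt_level.
  rewrite sumrB -natr_sum; set x := g 0 i => /andP[cx xn].
  have -> : (\sum_(t < n) (x <= c + t%:Z)%R = \sum_(t < n) (`|x - c| <= t))%N.
    by apply: eq_bigr => t _; congr nat_of_bool; apply/idP/idP; lia.
  rewrite sum_geq_ord /C -[X in _ - X = _]/((n - `|x - c|)%N%:Z%:~R).
  have -> : (n - `|x - c|)%N%:Z = c + n%:Z - x by lia.
  by rewrite [X in _ - X]rmorphB opprB addrA addrAC.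
have C0 (i : 'I_p) : C = 0.
  have : \sum_i rhs 0 i = 0.
    rewrite /rhs; under eq_bigr do rewrite summxE.
    rewrite exchange_big big1 // => t _.
    by rewrite sum_scaled_step_weight // level_le.
  under eq_bigr do rewrite rhsE.
  rewrite big_split /= sumr_const card_ord.
  have -> : \sum_i ratw g 0 i = 0.
    under eq_bigr do rewrite mxE.
    by rewrite -rmorph_sum trace_g.
  move/eqP; rewrite addr0 mulrn_eq0 => /orP[/eqP p0|/eqP //].
  by have := leq_ltn_trans (leq0n i) (ltn_ord i); rewrite {1}p0.
by apply/rowP => i; rewrite rhsE (C0 i) add0r.
Qed.

End Level.

Lemma step_pairD p1 p2 k1 k2 :
  step_pair p1 p2 k1 k2 = step_pair p1 p2 k1 0 + step_pair p1 p2 0 k2.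
Proof.
by rewrite /step_pair !step_weight0 !scaler0; congr pair; rewrite ?addr0 ?add0r.
Qed.

(** * Flags and coefficients *)

Section Flags.
Variables (K : fieldType) (V : vectType K) (p : nat) (b : p.-tuple V).

Lemma memv_flag k (i : 'I_p) : (i < k)%N -> b`_i \in flag b k.
Proof.
move=> ik; apply: memv_span; rewrite -(nth_take 0 ik) mem_nth //.
by rewrite size_take_min size_tuple leq_min ik /=.
Qed.

Lemma coord_flag k (j : 'I_p) v :
  free b -> (k <= j)%N -> v \in flag b k -> coord b j v = 0.
Proof.
move=> fb kj; suff /subvP sub : (flag b k <= lker (linfun (coord b j : V -> K^o)))%VS.
  by move/sub; rewrite memv_ker lfunE => /eqP.
apply/span_subvP => x /(nthP 0)[l].
rewrite size_take_min size_tuple leq_min => /andP[lk lp] <-.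
rewrite nth_take // memv_ker lfunE /= -[l]/(val (Ordinal lp)) coord_free //.
by rewrite -val_eqE /= ltn_eqF // (leq_trans lk).
Qed.

End Flags.

(** * The cone of basic weight vectors with prescribed maximiser *)

Section BasicCone.
Variables (K : fieldType) (V1 V2 : vectType K) (p1 p2 : nat).
Variables (b1 : p1.-tuple V1) (b2 : p2.-tuple V2).
Hypotheses (basis_b1 : basis_of fullv b1) (basis_b2 : basis_of fullv b2).
Variables (f : 'Hom(V1, V2)) (f_neq0 : f != 0).
Variables (i1 : 'I_p1) (i2 : 'I_p2).
Hypothesis fi_neq0 : coef b1 b2 f i1 i2 != 0.

Lemma mu_eq_elem (w : 'rV[rat]_p1 * 'rV[rat]_p2) :
  (forall i j, coef b1 b2 f i j != 0 ->
     - w.1 0 i + w.2 0 j <= - w.1 0 i1 + w.2 0 i2) ->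
  mu b1 b2 f w = mu b1 b2 (elem b1 b2 i1 i2) w.
Proof.
move=> opt.
have e0 : elem b1 b2 i1 i2 != 0.
  apply/eqP => e0; have := coef_elem basis_b1 basis_b2 i1 i2 i1 i2.
  by rewrite e0 /coef zero_lfunE linear0 !eqxx => /esym/eqP; rewrite oner_eq0.
have [[i [j [ij ->]]] _] := mu_max basis_b1 basis_b2 w e0.
move: ij; rewrite coef_elem //.
case: andP => [[/eqP<- /eqP<-] _|_]; last by rewrite eqxx.
have [[i' [j' [/opt le_opt muE]]] /(_ _ _ fi_neq0) ge_opt] :=
  mu_max basis_b1 basis_b2 w f_neq0.
by apply/eqP; rewrite eq_le ge_opt muE le_opt.
Qed.

Lemma mu_step_pair k1 k2 :
  (forall i j, coef b1 b2 f i j != 0 ->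
     (i < k1)%:R - (j < k2)%:R <= (i1 < k1)%:R - (i2 < k2)%:R :> rat) ->
  mu b1 b2 f (step_pair p1 p2 k1 k2)
    = mu b1 b2 (elem b1 b2 i1 i2) (step_pair p1 p2 k1 k2).
Proof.
by move=> opt; apply: mu_eq_elem => i j /opt; rewrite !scaled_step_weightE; lra.
Qed.

(** The bounds [0 < k1 < p1] and [0 < k2 < p2] come for free: the inclusion
moves each witness of the other two hypotheses across to the other index. *)
Lemma basic_of_coef k1 k2 :
  (forall i j, coef b1 b2 f i j != 0 -> (i < k1)%N -> (j < k2)%N) ->
  (exists i j, coef b1 b2 f i j != 0 /\ (i < k1)%N) ->
  (exists i j, coef b1 b2 f i j != 0 /\ (k2 <= j)%N) ->
  basic b1 b2 f k1 k2.
Proof.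
move=> sub [i [j [ij ik]]] [i' [j' [ij' jk']]]; right.
have jk := sub _ _ ij ik.
have ik' : (k1 <= i')%N.
  by rewrite leqNgt; apply: contraL jk' => /(sub _ _ ij'); rewrite ltnNge.
split.
- by rewrite (leq_ltn_trans _ ik) //= (leq_ltn_trans ik').
- by rewrite (leq_ltn_trans _ jk) //= (leq_ltn_trans jk').
- rewrite limg_span; apply/span_subvP => y /mapP[x /(nthP 0)[m]].
  rewrite size_take_min size_tuple leq_min => /andP[mk mp] <- ->.
  rewrite nth_take // (coord_basis basis_b2 (memvf (f _))).
  apply: memv_suml => l _; have [->|fml] := eqVneq (coord b2 l (f b1`_m)) 0.
    by rewrite scale0r mem0v.
  by apply/memvZ/memv_flag/(sub (Ordinal mp)).
- move=> /subvP/(_ _ (memv_flag b1 ik)); rewrite memv_ker => /eqP fb.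
  by move: ij; rewrite /coef fb linear0 eqxx.
- move=> /subvP/(_ _ (memv_img f (memvf b1`_i'))) fi'.
  by move: ij'; rewrite /coef (coord_flag (basis_free basis_b2) jk' fi') eqxx.
Qed.

(** Since the maximiser [(i1, i2)] is fixed, this set is closed under sums, so
that a decomposition can be built one summand at a time. *)
Definition basic_cone (w : 'rV[rat]_p1 * 'rV[rat]_p2) : Prop :=
  exists eta : 'I_p1 -> 'I_p2 -> rat,
    [/\ w = \sum_(k1 < p1) \sum_(k2 < p2) eta k1 k2 *: step_pair p1 p2 k1 k2,
        forall k1 k2, 0 <= eta k1 k2
      & forall k1 k2, eta k1 k2 != 0 ->
          basic b1 b2 f k1 k2 /\
          mu b1 b2 f (step_pair p1 p2 k1 k2)
            = mu b1 b2 (elem b1 b2 i1 i2) (step_pair p1 p2 k1 k2)].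

Lemma basic_cone0 : basic_cone 0.
Proof.
exists (fun _ _ => 0); split=> [||k1 k2 /eqP] //.
by rewrite big1 // => k1 _; rewrite big1 // => k2 _; rewrite scale0r.
Qed.

Lemma basic_coneD w w' : basic_cone w -> basic_cone w' -> basic_cone (w + w').
Proof.
move=> [eta [-> eta0 etaP]] [eta' [-> eta'0 eta'P]].
exists (fun k1 k2 => eta k1 k2 + eta' k1 k2); split=> [|k1 k2|k1 k2].
- rewrite -big_split; apply: eq_bigr => k1 _.
  by rewrite -big_split; apply: eq_bigr => k2 _; rewrite scalerDl.
- exact: addr_ge0.
- have [->|/etaP //] := eqVneq (eta k1 k2) 0.
  by rewrite add0r => /eta'P.
Qed.

Lemma basic_cone_generator (k1 : 'I_p1) (k2 : 'I_p2) :
  basic b1 b2 f k1 k2 ->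
  mu b1 b2 f (step_pair p1 p2 k1 k2)
    = mu b1 b2 (elem b1 b2 i1 i2) (step_pair p1 p2 k1 k2) ->
  basic_cone (step_pair p1 p2 k1 k2).
Proof.
move=> bas muE.
exists (fun m1 m2 => ((m1 == k1) && (m2 == k2))%:R); split=> [||m1 m2].
- rewrite (bigD1 k1) //= [X in _ + X]big1 ?addr0 => [|m1 /negPf m1k].
    rewrite (bigD1 k2) //= big1 ?addr0 => [|m2 /negPf m2k].
      by rewrite !eqxx scale1r.
    by rewrite m2k andbF scale0r.
  by rewrite big1 // => m2 _; rewrite m1k scale0r.
- by move=> m1 m2; rewrite ler0n.
- by rewrite pnatr_eq0 eqb0 negbK => /andP[/eqP-> /eqP->].
Qed.

(** The index [p1] is outside the allowed range, but it gives the zero vector,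
as does 0. *)
Lemma basic_cone_step_left k1 : (k1 <= p1)%N ->
  (forall i j, coef b1 b2 f i j != 0 -> (i < k1)%N -> (i1 < k1)%N) ->
  basic_cone (step_pair p1 p2 k1 0).
Proof.
rewrite leq_eqVlt => /predU1P[-> _|kp opt].
  rewrite /step_pair step_weight0 step_weight_full !scaler0; exact: basic_cone0.
have p2_gt0 : (0 < p2)%N by exact: leq_ltn_trans (ltn_ord i2).
apply: (@basic_cone_generator (Ordinal kp) (Ordinal p2_gt0)); first by left=> -[].
apply: mu_step_pair => i j /opt /=; rewrite !subr0 ler_nat.
by case: (i < k1)%N => // ->.
Qed.

Lemma basic_cone_step_right k2 : (k2 <= p2)%N ->
  (forall i j, coef b1 b2 f i j != 0 -> (i2 < k2)%N -> (j < k2)%N) ->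
  basic_cone (step_pair p1 p2 0 k2).
Proof.
rewrite leq_eqVlt => /predU1P[-> _|kp opt].
  rewrite /step_pair step_weight0 step_weight_full !scaler0; exact: basic_cone0.
have p1_gt0 : (0 < p1)%N by exact: leq_ltn_trans (ltn_ord i1).
apply: (@basic_cone_generator (Ordinal p1_gt0) (Ordinal kp)); first by left=> -[].
apply: mu_step_pair => i j /opt /=; rewrite !sub0r lerN2 ler_nat.
by case: (i2 < k2)%N => // ->.
Qed.

(** If [f] neither kills [V1^(k1)] nor maps into [V2^(k2)], the pair is itself
basic, with [k1] and [k2] then automatically interior. Otherwise it is split in
two: if [f] kills [V1^(k1)], then [i1 >= k1], hence [i2 >= k2]; if the image
lies in [V2^(k2)], then [i2 < k2], hence [i1 < k1]. In either case one summand
has constant weight on the support of [f], and for the other one [(i1, i2)] is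
on the side of the larger value. *)
Lemma basic_cone_step_pair k1 k2 : (k1 <= p1)%N -> (k2 <= p2)%N ->
  (forall i j, coef b1 b2 f i j != 0 -> (i < k1)%N -> (j < k2)%N) ->
  ((i2 < k2)%N -> (i1 < k1)%N) ->
  basic_cone (step_pair p1 p2 k1 k2).
Proof.
move=> kp1 kp2 sub sub'.
have [/existsP[i /existsP[j /andP[ij ik]]]|noi] :=
  boolP [exists i : 'I_p1, exists j, (coef b1 b2 f i j != 0) && (i < k1)%N].
  have [/existsP[i' /existsP[j' /andP[ij' jk']]]|noj] :=
    boolP [exists i, exists j : 'I_p2, (coef b1 b2 f i j != 0) && (k2 <= j)%N].
    have bas : basic b1 b2 f k1 k2.
      by apply: basic_of_coef => //; [exists i, j | exists i', j'].
    have lt2 : (k2 < p2)%N by exact: leq_ltn_trans (ltn_ord j').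
    have lt1 : (k1 < p1)%N.
      apply: leq_ltn_trans (ltn_ord i'); rewrite leqNgt.
      by apply: contraL jk' => /(sub _ _ ij'); rewrite ltnNge.
    apply: (@basic_cone_generator (Ordinal lt1) (Ordinal lt2) bas).
    have eq_lt : (i1 < k1)%N = (i2 < k2)%N by apply/idP/idP => // /(sub _ _ fi_neq0).
    apply: mu_step_pair => m1 m2 /sub /=; rewrite eq_lt subrr subr_le0 ler_nat.
    by case: (m1 < k1)%N => // ->.
  have all_lt m1 m2 : coef b1 b2 f m1 m2 != 0 -> (m2 < k2)%N.
    move=> m12; rewrite ltnNge; apply: contra noj => km.
    by apply/existsP; exists m1; apply/existsP; exists m2; rewrite m12.
  rewrite step_pairD; apply: basic_coneD.
    by apply: basic_cone_step_left => // _ _ _ _; apply/sub'/all_lt/fi_neq0.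
  by apply: basic_cone_step_right => // m1 m2 /all_lt.
have none_lt m1 m2 : coef b1 b2 f m1 m2 != 0 -> (m1 < k1)%N = false.
  move=> m12; apply: contraNF noi => km.
  by apply/existsP; exists m1; apply/existsP; exists m2; rewrite m12.
rewrite step_pairD; apply: basic_coneD.
  by apply: basic_cone_step_left => // m1 m2 /none_lt ->.
by apply: basic_cone_step_right => // m1 m2 _ /sub'; rewrite (none_lt _ _ fi_neq0).
Qed.

End BasicCone.

(** * The theorem *)

Theorem theorem3p4 (R : realType) (V1 V2 : vectType R[i]) (p1 p2 : nat)
  (dimV1 : \dim {:V1} = p1) (dimV2 : \dim {:V2} = p2)
  (p1_gt0 : (0 < p1)%N) (p2_gt0 : (0 < p2)%N)
  (f : 'Hom(V1, V2)) (f_neq0 : f != 0)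
  (b1 : p1.-tuple V1) (b2 : p2.-tuple V2)
  (basis_b1 : basis_of {:V1} b1) (basis_b2 : basis_of {:V2} b2)
  (g1 : 'rV[int]_p1) (g2 : 'rV[int]_p2)
  (weight_g1 : is_weight_vector g1) (weight_g2 : is_weight_vector g2) :
  exists (i1 : 'I_p1) (i2 : 'I_p2),
    [/\ coef b1 b2 f i1 i2 != 0,
        mu b1 b2 f (ratw g1, ratw g2)
          = mu b1 b2 (elem b1 b2 i1 i2) (ratw g1, ratw g2)
      & exists eta : 'I_p1 -> 'I_p2 -> rat,
        [/\ (ratw g1, ratw g2)
              = \sum_(k1 < p1) \sum_(k2 < p2) eta k1 k2 *: step_pair p1 p2 k1 k2,
            forall k1 k2, 0 <= eta k1 k2
          & forall k1 k2, eta k1 k2 != 0 ->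
              basic b1 b2 f k1 k2 /\
              mu b1 b2 f (step_pair p1 p2 k1 k2)
                = mu b1 b2 (elem b1 b2 i1 i2) (step_pair p1 p2 k1 k2)]].
Proof.
have [[i1 [i2 [fi muE]]] mu_ge] :=
  mu_max basis_b1 basis_b2 (ratw g1, ratw g2) f_neq0.
rewrite muE in mu_ge.
have le_max i j : coef b1 b2 f i j != 0 -> g2 0 j - g1 0 i <= g2 0 i2 - g1 0 i1.
  move/mu_ge; rewrite /= !mxE -!rmorphN -!rmorphD ler_int.
  by rewrite ![- _ + _]addrC.
exists i1, i2; split=> //; first exact: mu_eq_elem.
set m := g2 0 i2 - g1 0 i1 in le_max.
(* a range of thresholds for which all steps of both weight vectors occur *)
pose N := ((\sum_i `|g1 0%R i|) + (\sum_j `|g2 0%R j|) + `|m|)%N.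
have leN1 i : (`|g1 0%R i| <= \sum_i `|g1 0%R i|)%N by rewrite (bigD1 i) //= leq_addr.
have leN2 j : (`|g2 0%R j| <= \sum_j `|g2 0%R j|)%N by rewrite (bigD1 j) //= leq_addr.
have cake1 := @ratw_layer_cake _ _ weight_g1 (- N%:Z) (N + N).
have cake2 := @ratw_layer_cake _ _ weight_g2 (- N%:Z + m) (N + N).
rewrite -/(basic_cone b1 b2 f i1 i2 (ratw g1, ratw g2)).
rewrite cake1 => [|i]; last by have := leN1 i; rewrite /N; lia.
rewrite cake2 => [|j]; last by have := leN2 j; rewrite /N; lia.
have -> (I : finType) (u : I -> 'rV[rat]_p1) (v : I -> 'rV[rat]_p2) :
    (\sum_t u t, \sum_t v t) = \sum_t (u t, v t).
  by rewrite [RHS]surjective_pairing !raddf_sum.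
elim/big_ind: _ => [|w w'|t _]; [exact: basic_cone0 | exact: basic_coneD |].
apply: basic_cone_step_pair => //; rewrite ?level_le //.
  by move=> i j /le_max; rewrite !lt_level //; lia.
by rewrite !lt_level // /m; lia.
Qed.
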